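(* Let $d\ge 3$ and let $\eta$ be an $\mathbb{N}$-valued random variable with $\mathbf{P}[\eta\ge 1]>0$. Suppose that there exists $\delta>0$ such that $\mathbf{E}\,\eta^\delta<\infty$. Then $p_c(\mathbb{T}_d,\eta)>0$, i.e., the frog model $\mathrm{FM}(\mathbb{T}_d,p,\eta)$ dies out almost surely for $p>0$ small enough.
   Context: Here $\mathbb{N}=\{0,1,2,\dots\}$, and $\mathbb{T}_d$ denotes the infinite homogeneous tree in which every vertex has degree $d$, with a fixed root $\mathbf{0}$. Frog model $\mathrm{FM}(\mathcal{G},p,\eta)$. Let $\mathcal{G}$ be an infinite connected undirected graph all of whose sites (vertices) have finite degree, with a fixed site $\mathbf{0}$ called the root; let $p\in[0,1]$ and let $\eta$ be a random variable with values in $\mathbb{N}$. Let $\{\eta(x)\}_{x}$, $\{(S^x_n(i))_{n\in\mathbb{N}}\}_{x,\,i\ge1}$, $\{\Xi^x_p(i)\}_{x,\,i\ge 1}$ be independent families of independent random variables, where $\eta(x)$ has the law of $\eta$, $(S^x_n(i))_n$ is a discrete-time simple random walk on $\mathcal{G}$ started from $x$, and $\mathbf{P}[\Xi^x_p(i)=k]=(1-p)p^{k-1}$, $k=1,2,\dots$ (for $p=1$, $\Xi^x_p(i)=\infty$, no death). Site $x$ initially contains $\eta(x)$ particles; at time $0$ all particles are sleeping except those at the root, which are active. If the particles of site $x$ are activated at time $T(x)$, the $i$-th of them ($1\le i\le\eta(x)$) is active and located at $S^x_n(i)$ at time $T(x)+n$ for $0\le n<\Xi^x_p(i)$, and then disappears.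 When an active particle visits a site, all sleeping particles there become active. Formally, $t(x,y)=\min_{1\le i\le\eta(x)}\min\{n<\Xi^x_p(i):S^x_n(i)=y\}$ for $x\ne y$ ($\infty$ if there is no such $n$), and $T(x)=\inf\{t(x_0,x_1)+\dots+t(x_{m-1},x_m)\}$ over all finite sequences $\mathbf{0}=x_0,x_1,\dots,x_m=x$, with $T(\mathbf{0})=0$; $T(x)=\infty$ means that $x$ is never visited by active particles. The model survives if at every time there is at least one active particle; otherwise it dies out. The critical parameter is $p_c(\mathcal{G},\eta)=\inf\{p\in[0,1]:\mathbf{P}[\mathrm{FM}(\mathcal{G},p,\eta)\text{ survives}]>0\}$. *)

(* Defs.v *)
From HB Require Import structures.
From mathcomp Require Import all_boot all_order all_algebra.
From mathcomp Require Import finmap.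
From mathcomp Require Import all_classical all_reals all_analysis.

Set Implicit Arguments.
Unset Strict Implicit.
Unset Printing Implicit Defensive.

Import Order.TTheory GRing.Theory Num.Theory.

Local Open Scope classical_set_scope.
Local Open Scope ring_scope.

(* Infinite connected locally finite simple graphs with a root. Such a graph
   has countably many sites, so taking a countType loses no generality. *)
Record rooted_graph := RootedGraph {
  site :> countType;
  adj : rel site;
  origin : site;
  adj_sym : symmetric adj;
  adj_irrefl : irreflexive adj;
  adj_connected : forall x y : site, exists2 s, path adj x s & last x s = y;
  adj_finite : forall x : site, finite_set [set y | adj x y];
  site_infinite : infinite_set [set: site] }.

Definition degree (G : rooted_graph) (x : G) : nat :=
  #|` fset_set [set y | adj x y]|.

Definition acyclic_graph (G : rooted_graph) : Prop :=
  forall c : seq G, ucycle (@adj G) c -> (size c < 3)%N.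

Definition homogeneous_tree (d : nat) (G : rooted_graph) : Prop :=
  acyclic_graph G /\ forall x : G, degree x = d.

(* The sigma-algebra generated by a family of random elements with values in a
   countable set (equipped with the discrete sigma-algebra). *)
Definition sigma_of (I Omega : Type) (S : countType) (X : I -> Omega -> S) :
    set (set Omega) :=
  <<s [set A | exists i s, A = X i @^-1` [set s]] >>.

Definition mutual_independence (R : realType) (d : measure_display)
    (Omega : measurableType d) (P : probability Omega R)
    (J : eqType) (F : J -> set (set Omega)) : Prop :=
  forall (s : seq J) (A : J -> set Omega), uniq s ->
    (forall j, j \in s -> F j (A j)) ->
    P (\bigcap_(j in [set` s]) A j) = (\prod_(j <- s) P (A j))%E.

(* The random elements driving the model. The particles of site x are numbered
   0, ..., nfrogs x - 1 (instead of 1, ..., eta(x)); walk x i n is S^x_n(i);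
   life x i is Xi^x_p(i), where None stands for infinity. *)
Record frogs (G : rooted_graph) (Omega : Type) := Frogs {
  nfrogs : G -> Omega -> nat;
  walk : G -> nat -> nat -> Omega -> G;
  life : G -> nat -> Omega -> option nat }.

Definition before_death (n : nat) (l : option nat) : bool :=
  if l is Some k then (n < k)%N else true.

Section Dynamics.
Context (R : realType) (G : rooted_graph) (Omega : Type) (F : frogs G Omega).

Definition passage (x y : G) (w : Omega) : \bar R :=
  ereal_inf [set n%:R%:E | n in [set n : nat | exists i : nat,
    [/\ (i < nfrogs F x w)%N, before_death n (life F x i w)
      & walk F x i n w = y]]].

Fixpoint passage_along (x : G) (s : seq G) (w : Omega) : \bar R :=
  if s is y :: s' then (passage x y w + passage_along y s' w)%E else 0%E.

Definition activation (x : G) (w : Omega) : \bar R :=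
  ereal_inf [set passage_along (origin G) s w | s in [set s : seq G |
    path (fun y z => y != z) (origin G) s /\ last (origin G) s = x]].

Definition active_at (x : G) (i n : nat) (w : Omega) : Prop :=
  (i < nfrogs F x w)%N /\
  exists2 k : nat, (activation x w + k%:R%:E = n%:R%:E)%E
                 & before_death k (life F x i w).

Definition survival : set Omega :=
  [set w | forall n, exists x i, active_at x i n w].

End Dynamics.
Arguments survival R {G Omega} F.

Section Law.
Context (R : realType) (G : rooted_graph) (d : measure_display)
  (Omega : measurableType d) (P : probability Omega R).

Definition srw_step (x y : G) : R :=
  if adj x y then (degree x)%:R^-1 else 0.

Definition simple_random_walk (x : G) (S : nat -> Omega -> G) : Prop :=
  P (S 0%N @^-1` [set x]) = 1%E /\
  forall (n : nat) (v : nat -> G),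
    P [set w | forall k, (k <= n.+1)%N -> S k w = v k] =
    (P [set w | forall k, (k <= n)%N -> S k w = v k]
       * (srw_step (v n) (v n.+1))%:E)%E.

Definition geometric_lifetime (p : R) (X : Omega -> option nat) : Prop :=
  (forall k : nat, P (X @^-1` [set Some k.+1]) = ((1 - p) * p ^+ k)%:E) /\
  (p = 1 -> P (X @^-1` [set None]) = 1%E).

Definition frogs_index : eqType := (G + (G * nat + G * nat))%type.

Definition frogs_sigma (F : frogs G Omega) (j : frogs_index) :
    set (set Omega) :=
  match j with
  | inl x => sigma_of (fun _ : unit => nfrogs F x)
  | inr (inl (x, i)) => sigma_of (walk F x i)
  | inr (inr (x, i)) => sigma_of (fun _ : unit => life F x i)
  end.

Definition frog_model (p : R) (mu : probability nat R) (F : frogs G Omega) :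
    Prop :=
  [/\ forall j, frogs_sigma F j `<=` measurable,
      mutual_independence P (frogs_sigma F),
      forall x k, P (nfrogs F x @^-1` [set k]) = mu [set k],
      forall x i, simple_random_walk x (walk F x i)
    & forall x i, geometric_lifetime p (life F x i)].

End Law.

(* The law of the driving family, hence the probability of survival, is
   determined by G, p and the law mu of eta, so the two definitions below do not
   depend on the probability space on which FM(G,p,eta) is realized. *)
Definition survives_with_positive_probability (R : realType) (G : rooted_graph)
    (p : R) (mu : probability nat R) : Prop :=
  exists (d : measure_display) (Omega : measurableType d)
    (P : probability Omega R) (F : frogs G Omega),
    frog_model P p mu F /\ (0 < P (survival R F))%E.

Definition dies_out_almost_surely (R : realType) (G : rooted_graph)
    (p : R) (mu : probability nat R) : Prop :=
  forall (d : measure_display) (Omega : measurableType d)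
    (P : probability Omega R) (F : frogs G Omega),
    frog_model P p mu F -> P (~` survival R F) = 1%E.

(* The infimum is taken in \bar R. It is a real number as soon as eta >= 1 with
   positive probability, since p = 1 then belongs to the set. *)
Definition p_c (R : realType) (G : rooted_graph) (mu : probability nat R) :
    \bar R :=
  ereal_inf [set p%:E | p in
    [set p : R | 0 <= p <= 1 /\ survives_with_positive_probability G p mu]].

(* Main.v *)
Require Import Defs.
From HB Require Import structures.
From mathcomp Require Import all_boot all_order all_algebra.
From mathcomp Require Import all_classical all_reals all_analysis.
From mathcomp Require Import measurable_realfun ring.

Set Implicit Arguments.
Unset Strict Implicit.
Unset Printing Implicit Defensive.

Import Order.TTheory GRing.Theory Num.Theory.
Import numFieldNormedType.Exports.

Local Open Scope classical_set_scope.
Local Open Scope ring_scope.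

(* A frog of site x can only wake up a site at distance k >= 1 if one of the
   frogs of x lives longer than k steps, an event which does not involve the
   walks and whose probability is at most
     E min(1, eta p^k) <= E eta^a p^(a k)  with a = min(delta, 1).
   These events are independent for distinct sites. If the process survives
   then (almost surely) infinitely many sites are woken up, hence some site far
   away from the root, which yields for every n a walk of n steps from the root,
   cut into legs with distinct starting sites, such that each starting site has
   a frog outliving its leg. There are (2 d)^n such walks with cuts, each of
   probability at most (C p^a)^n where C = max(1, E eta^a), so that survival has
   probability at most (2 d C p^a)^n for every n. *)

(** * Auxiliary facts on geometric sequences, real powers and finite unions *)

Lemma le0_geometric (R : realType) (q : R) (x : \bar R) :
  0 <= q < 1 -> (forall k, (x <= (q ^+ k)%:E)%E) -> (x <= 0)%E.
Proof.
move=> /andP[q0 q1] xq; have qk : ((q ^+ k)%:E @[k --> \oo] --> 0%:E)%E.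
  by apply: cvg_EFin; [exact: nearW|apply: cvg_expr; rewrite ger0_norm].
by apply: (cvge_to_ge qk); exact: nearW.
Qed.

Lemma powR_exprn (R : realType) (x a : R) n :
  0 <= x -> (x ^+ n) `^ a = (x `^ a) ^+ n.
Proof.
move=> x0; rewrite -(powR_mulrn n x0) -powRrM mulrC powRrM.
by rewrite powR_mulrn // powR_ge0.
Qed.

Lemma measure_bigsetU_le (R : realType) (d : measure_display)
    (T : measurableType d) (P : {measure set T -> \bar R}) (I : Type)
    (r : seq I) (Q : pred I) (A : I -> set T) (y : I -> \bar R) :
  (forall i, Q i -> measurable (A i)) -> (forall i, Q i -> (P (A i) <= y i)%E) ->
  (P (\big[setU/set0]_(i <- r | Q i) A i) <= \sum_(i <- r | Q i) y i)%E.
Proof.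
move=> mA Ay; elim: r => [|i r IHr]; first by rewrite !big_nil measure0.
rewrite !big_cons; case: ifP => // Qi.
apply: le_trans (measureU2 _ (mA _ Qi) (bigsetU_measurable _ mA)) _.
by apply: leeD => //; exact: Ay.
Qed.

(** * Marked walks *)

Section MarkedWalks.
Context (G : rooted_graph).

Definition nbrs (x : G) : seq G :=
  finmap.enum_fset (fset_set [set y | adj x y]).

Lemma mem_nbrs (x y : G) : (y \in nbrs x) = adj x y.
Proof.
rewrite /nbrs in_fset_set; last exact: adj_finite.
by apply/idP/idP; rewrite inE.
Qed.

Fixpoint marked_walks (n : nat) (x : G) : seq (seq (G * bool)) :=
  if n is m.+1 then
    [seq u :: t | u <- [seq (y, b) | y <- nbrs x, b <- [:: true; false]],
                  t <- marked_walks m u.1]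
  else [:: [::]].

Lemma size_marked_walks (d : nat) : (forall x : G, degree x = d) ->
  forall n x, size (marked_walks n x) = ((2 * d) ^ n)%N.
Proof.
move=> dG; elim=> [|n IHn] x //=.
rewrite size_allpairs_dep (eq_map (fun u => IHn u.1)).
rewrite sumnE big_map big_const_seq count_predT iter_addn_0.
rewrite (size_allpairs pair (nbrs x) [:: true; false]) [size (nbrs x)]dG.
by rewrite expnSr [(2 * d)%N]mulnC.
Qed.

Lemma mem_marked_walks (x : G) t :
  path (@adj G) x (map fst t) -> t \in marked_walks (size t) x.
Proof.
elim: t x => [|[y b] t IHt] x /=; first by rewrite inE.
case/andP=> xy yt; apply/allpairsPdep; exists (y, b), t; split=> //=.
  by apply: (allpairs_f pair (t := [:: true; false])); [rewrite mem_nbrs|case: b].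
exact: IHt.
Qed.

(* A mark on a step means that its endpoint wakes up and takes over; the legs
   list the successive relay sites with the distance walked by their frog. *)
Fixpoint legs (x : G) (k : nat) (t : seq (G * bool)) : seq (G * nat) :=
  match t with
  | [::] => [:: (x, k)]
  | (y, true) :: t' => (x, k.+1) :: legs y 0 t'
  | (_, false) :: t' => legs x k.+1 t'
  end.

(** Here [k] counts the steps already walked on the current leg. The total length is the exponent in
    the probability bound, so a chain of n steps costs an n-th power wherever its marks lie. *)
Lemma sumn_legs x k t : sumn (map snd (legs x k t)) = (k + size t)%N.
Proof.
elim: t x k => [|[y []] t IHt] x k //=; rewrite IHt //.
by rewrite addnS.
by rewrite addnS.
Qed.

Lemma legs_cat_unmarked x k q t :
  legs x k ([seq (y, false) | y <- q] ++ t) = legs x (k + size q) t.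
Proof.
by elim: q k => [|y q IHq] k /=; rewrite ?addn0 // IHq addSnnS.
Qed.

(** Truncation only drops the later relays, so distinctness of the relay sites passes to truncated
    chains. *)
Lemma legs_take x k t n :
  prefix (map fst (legs x k (take n t))) (map fst (legs x k t)).
Proof.
have legs_head x' k' t' : prefix [:: x'] (map fst (legs x' k' t')).
  by elim: t' k' => [|[y []] t' IHt'] k' /=; rewrite ?eqxx ?prefix0s //.
elim: t x k n => [|[y b] t IHt] x k [|n]; try exact: legs_head.
by case: b => /=; rewrite ?eqxx IHt.
Qed.

End MarkedWalks.

(** * Deterministic part: chains of relays for a fixed outcome *)

Section Chains.
Context (R : realType) (G : rooted_graph) (Omega : Type) (F : frogs G Omega).

(* The case [u.2 = 0] imposes nothing: the last leg of a chain may be empty and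
   start at a site without frogs. *)
Definition far (u : G * nat) : set Omega :=
  [set w | u.2 = 0%N \/ exists2 i : nat, (i < nfrogs F u.1 w)%N
                           & before_death u.2 (life F u.1 i w)].

Definition all_far (r : seq (G * nat)) : set Omega :=
  [set w | forall u, u \in r -> far u w].

Lemma all_far_cons u r : all_far (u :: r) = far u `&` all_far r.
Proof.
apply/seteqP; split=> w /=.
  by move=> uw; split=> [|v vr]; apply: uw; rewrite inE ?eqxx ?vr ?orbT.
by move=> [uw rw] v; rewrite inE => /predU1P[->|/rw].
Qed.

Lemma far_leq x m n : (m <= n)%N -> far (x, n) `<=` far (x, m).
Proof.
move=> mn w; rewrite /far /=; case=> [n0|[i ix ni]].
  by left; apply/eqP; rewrite -leqn0 -n0.
right; exists i => //; move: ni; case: life => //= l; exact: leq_ltn_trans.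
Qed.

Lemma all_far_legs_leq x k t : all_far (legs x k t) `<=` far (x, k).
Proof.
elim: t x k => [|[y b] t IHt] x k w /=; first by apply; rewrite inE.
case: b; last by move=> /IHt; apply: far_leq.
by rewrite all_far_cons => -[+ _]; apply: far_leq.
Qed.

(** Legs completed before the cut are intact and the last one kept is at most shortened; a frog
    outliving a leg outlives any shorter one. *)
Lemma all_far_legs_take x k t n :
  all_far (legs x k t) `<=` all_far (legs x k (take n t)).
Proof.
elim: t x k n => [|[y b] t IHt] x k [|n] //= w.
  move=> /(all_far_legs_leq (t := (y, b) :: t)) xkw u.
  by rewrite inE => /eqP->.
by case: b; [rewrite !all_far_cons => -[? /IHt]|move=> /IHt].
Qed.

Definition reach (w : Omega) : rel G := fun x y => `[< exists n i,
  [/\ (i < nfrogs F x w)%N, before_death n (life F x i w)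
    & walk F x i n w = y] >].

Definition nearest_neighbour (w : Omega) :=
  forall x i, walk F x i 0 w = x /\
    forall n, adj (walk F x i n w) (walk F x i n.+1 w).

Lemma walk_path w x i n : nearest_neighbour w ->
  exists q : seq G, [/\ size q = n, path (@adj G) x q
                      & last x q = walk F x i n w].
Proof.
move=> /(_ x i)[w0 wadj]; elim: n => [|n [q [sq pq lq]]]; first by exists [::].
exists (rcons q (walk F x i n.+1 w)).
by rewrite size_rcons rcons_path last_rcons sq pq lq wadj.
Qed.

(** The trajectories of the frogs realizing the successive relations [reach] are concatenated, and
    the last step of each is marked. *)
Lemma reach_path_marked w x s : nearest_neighbour w ->
    path (reach w) x s -> uniq (x :: s) ->
  exists t, [/\ path (@adj G) x (map fst t), last x (map fst t) = last x s,
    map fst (legs x 0 t) = x :: s & all_far (legs x 0 t) w].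
Proof.
move=> nnw; elim: s x => [|y s IHs] x.
  by exists [::]; split=> //= u; rewrite inE => /eqP->; left.
rewrite [path _ _ _]/= => /andP[/asboolP[n [i [ix ni wy]]] ys].
rewrite cons_uniq => /andP[xys uys].
have [t [pt lt mt ft]] := IHs _ ys uys.
have [q [sq pq]] := walk_path x i n nnw; rewrite wy.
case/lastP: q sq pq => [|q z].
  (* A trajectory without steps would give y = x, against distinctness of the sites. *)
  by move=> _ _ /= xy; move: xys; rewrite xy inE eqxx.
rewrite size_rcons last_rcons rcons_path => nq /andP[pq az] zy; subst z.
exists ([seq (z, false) | z <- q] ++ (y, true) :: t).
have idq : [seq u.1 | u <- [seq (z, false) | z <- q]] = q.
  by rewrite -map_comp map_id_in.
split.
- by rewrite map_cat idq cat_path pq /= az.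
- by rewrite map_cat idq last_cat.
- by rewrite legs_cat_unmarked /= mt.
- rewrite legs_cat_unmarked /= add0n nq all_far_cons; split=> //.
  by right; exists i.
Qed.

Lemma passage_ge0 x y w : (0 <= passage R F x y w)%E.
Proof.
by apply/ereal_infP => _ [n _ <-]; rewrite lee_fin.
Qed.

Lemma passage_along_ge0 x s w : (0 <= passage_along R F x s w)%E.
Proof.
elim: s x => //= y s IHs x; apply: adde_ge0; last exact: IHs.
exact: passage_ge0.
Qed.

Lemma passage_along_reach x s w :
  (passage_along R F x s w < +oo)%E -> path (reach w) x s.
Proof.
elim: s x => //= y s IHs x.
have := passage_ge0 x y w; have := passage_along_ge0 y s w.
case E1: (passage_along R F y s w) => [a| |] //; last first.
  by case: (passage R F x y w).
move=> a0; case E2: (passage R F x y w) => [b| |] // b0 _.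
rewrite IHs ?E1 ?ltry // andbT; apply/asboolP.
have : (passage R F x y w < +oo)%E by rewrite E2 ltry.
by move=> /ereal_inf_lt[_ [n [i H] _]] _; exists n, i.
Qed.

Definition activated (w : Omega) : set G :=
  [set x | (activation R F x w < +oo)%E].

Lemma activated_reach w x : activated w x ->
  exists2 s, path (reach w) (origin G) s & last (origin G) s = x.
Proof.
move=> /ereal_inf_lt[_ [s [_ lx] <-]] /passage_along_reach ps.
by exists s.
Qed.

Lemma ball_finite (x : G) n :
  finite_set [set y | exists s, [/\ path (@adj G) x s, (size s < n)%N
                                  & last x s = y]].
Proof.
(* Marks do not affect endpoints: every walk shorter than [n] occurs here with all its marks set to
   [true]. *)
pose l := flatten [seq [seq last x (map fst t) | t <- marked_walks m x]
                  | m <- iota 0 n].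
apply: (@sub_finite_set _ _ [set` l]) => [y [s [ps sn <-]]|];
  last exact: finite_seq.
apply/flatten_mapP; exists (size s); first by rewrite mem_iota.
have := @mem_marked_walks _ x [seq (z, true) | z <- s].
rewrite -map_comp map_id_in // size_map => /(_ ps) h.
apply/mapP; exists [seq (z, true) | z <- s] => //.
by rewrite -map_comp map_id_in.
Qed.

(** Balls are finite, so some activated site is at distance at least [n] from the root. A relay path
    to it yields a chain of at least [n] steps, which is then cut after [n] steps. *)
Lemma infinite_activated_chain w n : nearest_neighbour w ->
    infinite_set (activated w) ->
  exists t, [/\ t \in marked_walks n (origin G),
    uniq (map fst (legs (origin G) 0 t)) & all_far (legs (origin G) 0 t) w].
Proof.
move=> nnw infA.
have [x Ax xfar] : exists2 x, activated w x &
    forall s, path (@adj G) (origin G) s -> last (origin G) s = x ->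
      (n <= size s)%N.
  apply: contrapT => h; apply: infA.
  apply: sub_finite_set (ball_finite (origin G) n) => x Ax /=.
  apply: contrapT => nex; apply: h; exists x => // s ps lx.
  by rewrite leqNgt; apply/negP => sn; apply: nex; exists s.
have [s ps lx] := activated_reach Ax.
(* Erasing loops makes the relay sites distinct, as the later independence argument requires. *)
case/shortenP: ps lx => s' ps' us' _ lx.
have [t [pt lt mt ft]] := reach_path_marked nnw ps' us'.
exists (take n t).
have tn : size (take n t) = n.
  by rewrite size_takel // -(size_map fst) xfar // lt.
split.
- rewrite -[X in marked_walks X _]tn; apply: mem_marked_walks.
  by rewrite map_take take_path.
- have /prefixP[r E] := legs_take (origin G) 0 t n.
  by move: us'; rewrite -mt E cat_uniq => /andP[].
- exact: all_far_legs_take.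
Qed.

Definition mortal (w : Omega) := forall x i, life F x i w <> None.

(** Finitely many activated sites carry finitely many frogs, all with finite lifetimes, so activity
    would stop at some time. *)
Lemma survival_infinite w : mortal w -> survival R F w ->
  infinite_set (activated w).
Proof.
move=> mw sw /finite_seqP[s As].
have bnd x : exists m, forall i n, active_at R F x i n w -> (n <= m)%N.
  have [[i0 [n0 [ix0 [k0 e0 _]]]]|nex] :=
    pselect (exists i n, active_at R F x i n w); last first.
    by exists 0%N => i n xin; case: nex; exists i, n.
  pose l i := odflt 0%N (life F x i w).
  (* The activation time T of [x] satisfies T + k0 = n0, so T is at most [n0]; no frog of [x] is
     active for longer than the largest lifetime there. *)
  exists (n0 + \max_(i < nfrogs F x w) l i)%N => i n [ix [k e kl]].
  have kl' : (k <= \max_(i < nfrogs F x w) l i)%N.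
    apply: leq_trans (leq_bigmax (Ordinal ix)).
    by move: kl; rewrite /l /=; case: life (mw x i) => //= a _ /ltnW.
  apply: leq_trans (leq_add (leqnn n0) kl').
  move: e0 e; case: activation => // a [e0] [e].
  by rewrite -(ler_nat R) natrD -e -e0 lerD2r lerDl.
have [m mP] := choice bnd.
have [x [i xi]] := sw (\max_(x <- s) m x).+1.
have xs : x \in s.
  suff : activated w x by rewrite As.
  case: xi => _ [k + _]; rewrite /activated /=.
  by case: activation => // a; rewrite ltry.
have := mP x i _ xi; rewrite leqNgt ltnS.
by rewrite (@leq_bigmax_seq _ s xpredT m x).
Qed.

End Chains.

(** * Measurability and almost sure properties *)

Section Measurability.
Context (G : rooted_graph).

(** Since [S] is countable, the preimage is a countable union of fibres, enumerated through
    [unpickle]; integers coding no element contribute the empty set. *)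
Lemma sigma_of_preimage (I Omega : Type) (S : countType) (X : I -> Omega -> S)
  (i : I) (A : set S) : sigma_of X (X i @^-1` A).
Proof.
pose B n : set Omega :=
  if @unpickle S n is Some s then [set w | X i w = s /\ A s] else set0.
have -> : X i @^-1` A = \bigcup_n B n.
  apply/seteqP; split => w /=.
    by move=> Aw; exists (pickle (X i w)) => //; rewrite /B pickleK.
  by move=> [n _]; rewrite /B; case: unpickle => // s [->].
have [s0 _ sU] := smallest_sigma_algebra setT
  [set A | exists i s, A = X i @^-1` [set s]].
apply: sU => n; rewrite /B.
case: unpickle => [s|]; last exact: s0.
have [As|nAs] := pselect (A s).
  have -> : [set w | X i w = s /\ A s] = X i @^-1` [set s].
    by apply/seteqP; split => w //= -[].
  by move=> M [_]; apply; exists i, s.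
suff -> : [set w | X i w = s /\ A s] = set0 by exact: s0.
by apply/seteqP; split => w //= -[].
Qed.

Context (d : measure_display) (Omega : measurableType d) (F : frogs G Omega).
Hypothesis mF : forall j, frogs_sigma F j `<=` measurable.

Lemma measurable_nfrogs x (A : set nat) : measurable (nfrogs F x @^-1` A).
Proof.
apply: (@mF (inl x)).
exact: (@sigma_of_preimage _ _ _ (fun _ : unit => nfrogs F x) tt A).
Qed.

Lemma measurable_life x i (A : set (option nat)) :
  measurable (life F x i @^-1` A).
Proof.
apply: (@mF (inr (inr (x, i)))).
exact: (@sigma_of_preimage _ _ _ (fun _ : unit => life F x i) tt A).
Qed.

Lemma measurable_walk x i n (A : set G) : measurable (walk F x i n @^-1` A).
Proof.
apply: (@mF (inr (inl (x, i)))).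
exact: (@sigma_of_preimage _ _ _ (walk F x i) n A).
Qed.

Lemma measurable_far u : measurable (far F u).
Proof.
case: u => x [|k].
  by rewrite (_ : far _ _ = setT) //; apply/seteqP; split=> w //= _; left.
rewrite (_ : far _ _ = \bigcup_i (nfrogs F x @^-1` [set n | (i < n)%N] `&`
    life F x i @^-1` [set l | before_death k.+1 l])).
  apply: bigcupT_measurable => i; apply: measurableI.
    exact: measurable_nfrogs.
  exact: measurable_life.
apply/seteqP; split => w; first by case=> // -[i ix li]; exists i.
by case=> i _ [ix li]; right; exists i.
Qed.

Lemma measurable_all_far r : measurable (all_far F r).
Proof.
elim: r => [|u r IHr].
  by rewrite (_ : all_far _ _ = setT) //; apply/seteqP; split=> w.
by rewrite all_far_cons; apply: measurableI => //; exact: measurable_far.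
Qed.

Context (R : realType).

Lemma emeasurable_fun_lt (f : Omega -> \bar R) :
    (forall r : R, measurable [set w | (f w < r%:E)%E]) ->
  measurable_fun setT f.
Proof.
move=> mf; apply: (measurability _ (ErealGenInftyO.measurableE R)).
move=> _ [_ [r ->] <-]; rewrite setTI.
rewrite (_ : _ @^-1` _ = [set w | (f w < r%:E)%E]) //.
Qed.

Lemma measurable_passage x y : measurable_fun setT (passage R F x y).
Proof.
apply: emeasurable_fun_lt => r.
rewrite (_ : [set _ | _] = \bigcup_(n in [set n | (n%:R < r)%R]) \bigcup_i
    (nfrogs F x @^-1` [set m | (i < m)%N] `&`
     life F x i @^-1` [set l | before_death n l] `&`
     walk F x i n @^-1` [set y])).
  apply: bigcup_measurable => n _; apply: bigcupT_measurable => i.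
  by apply: measurableI; [apply: measurableI; [exact: measurable_nfrogs|
    exact: measurable_life]|exact: measurable_walk].
apply/seteqP; split => w /=.
  move=> /ereal_inf_lt[_ [n [i [? ? ?]] <-]]; rewrite lte_fin => nr.
  by exists n => //; exists i.
move=> [n /= nr [i _ [[? ?] ?]]]; apply/ereal_inf_ltP.
by exists n%:R%:E; rewrite ?lte_fin //; exists n => //; exists i.
Qed.

Lemma measurable_passage_along x s :
  measurable_fun setT (passage_along R F x s).
Proof.
elim: s x => [|y s IHs] x /=; first exact: measurable_cst.
by apply: emeasurable_funD => //; exact: measurable_passage.
Qed.

(** The infimum is below r as soon as one sequence of sites achieves it, and there are countably
    many finite sequences. *)
Lemma measurable_activation x : measurable_fun setT (activation R F x).
Proof.
apply: emeasurable_fun_lt => r.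
pose D s : Prop :=
  path (fun y z : G => y != z) (origin G) s /\ last (origin G) s = x.
rewrite (_ : [set _ | _] = \bigcup_(s : seq G)
    [set w | D s /\ (passage_along R F (origin G) s w < r%:E)%E]).
  apply: countable_bigcupT_measurable => [|s]; first exact: countableP.
  have [Ds|nDs] := pselect (D s); last first.
    by rewrite (_ : [set _ | _] = set0) //; apply/seteqP; split=> w //= -[].
  rewrite (_ : [set _ | _] =
    setT `&` [set w | (passage_along R F (origin G) s w < r%:E)%E]).
    by apply: emeasurable_fun_infty_o => //; exact: measurable_passage_along.
  by rewrite setTI; apply/seteqP; split => w //= -[].
apply/seteqP; split => w /=.
  by move=> /ereal_inf_lt[_ [s Ds <-] sr]; exists s.
move=> [s _ [Ds sr]]; apply/ereal_inf_ltP.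
by exists (passage_along R F (origin G) s w) => //; exists s.
Qed.

Lemma measurable_active_at x i n : measurable (active_at R F x i n).
Proof.
(* The equation T + k = n is solved for T, which leaves for each [k] a condition on the value of the
   activation time. *)
rewrite (_ : active_at R F x i n =
  nfrogs F x @^-1` [set m | (i < m)%N] `&` \bigcup_k
  (activation R F x @^-1` [set (n%:R - k%:R)%:E] `&`
   life F x i @^-1` [set l | before_death k l])).
  apply: measurableI; first exact: measurable_nfrogs.
  apply: bigcupT_measurable => k; apply: measurableI; last exact: measurable_life.
  rewrite -[X in measurable X]setTI; apply: measurable_activation => //.
apply/seteqP; split => w [ix].
  move=> [k e kl]; split=> //; exists k => //; split=> //=.
  by move: e; case: activation => // a [<-]; rewrite addrK.
by move=> [k _ [/= e kl]]; split=> //; exists k => //; rewrite e -EFinD subrK.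
Qed.

Lemma measurable_survival : measurable (survival R F).
Proof.
rewrite (_ : survival R F =
  \bigcap_n \bigcup_(x : G) \bigcup_i active_at R F x i n).
  apply: bigcapT_measurable => n.
  apply: countable_bigcupT_measurable => [|x]; first exact: countableP.
  by apply: bigcupT_measurable => i; exact: measurable_active_at.
apply/seteqP; split => w sw.
  by move=> n _; have [x [i xi]] := sw n; exists x => //; exists i.
by move=> n; have [x _ [i _ xi]] := sw n I; exists x, i.
Qed.

End Measurability.

Section AlmostSure.
Context (R : realType) (G : rooted_graph) (d : measure_display)
  (Omega : measurableType d) (P : probability Omega R).

Lemma ae_forall_countable (T : countType) (Q : T -> Omega -> Prop) :
  (forall t, \forall w \ae P, Q t w) -> \forall w \ae P, forall t, Q t w.
Proof.
move=> aeQ.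
have : \forall w \ae P, forall n,
    if @unpickle T n is Some t then Q t w else True.
  by apply: ae_foralln => n; case: unpickle => [t|]; [exact: aeQ|apply: nearW].
by apply: filterS => w Qw t; have := Qw (pickle t); rewrite pickleK.
Qed.

Lemma ae_notin (A : set Omega) :
  measurable A -> P A = 0%E -> \forall w \ae P, ~ A w.
Proof.
move=> mA A0; exists A; split=> // w /=; exact: contrapT.
Qed.

Lemma ae_in (A : set Omega) :
  measurable A -> P A = 1%E -> \forall w \ae P, A w.
Proof.
move=> mA A1; have : \forall w \ae P, ~ (~` A) w.
  apply: ae_notin; first exact: measurableC.
  by rewrite probability_setC // A1 subee.
by apply: filterS => w /contrapT.
Qed.

(** Each finite trajectory whose step from time n to n+1 is not an edge has probability 0, and there
    are countably many of them. *)
Lemma simple_random_walk_adj (x : G) (S : nat -> Omega -> G) n :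
    (forall k s, measurable (S k @^-1` [set s])) ->
    simple_random_walk P x S ->
  \forall w \ae P, adj (S n w) (S n.+1 w).
Proof.
move=> mS [_ srw].
have : \forall w \ae P, forall v : seq G,
    ~~ adj (nth x v n) (nth x v n.+1) ->
    ~ (forall k, (k <= n.+1)%N -> S k w = nth x v k).
  apply: ae_forall_countable => v.
  case: (boolP (adj (nth x v n) (nth x v n.+1))) => [_|nadj].
    exact: nearW.
  suff : \forall w \ae P,
      ~ [set w | forall k, (k <= n.+1)%N -> S k w = nth x v k] w.
    by apply: filterS.
  apply: ae_notin; last first.
    by rewrite srw /srw_step (negbTE nadj) mule0.
  rewrite (_ : [set _ | _] = \bigcap_(k in [set k | (k <= n.+1)%N])
                                S k @^-1` [set nth x v k]).
    by apply: bigcap_measurable => [|k _]; [exists 0%N|exact: mS].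
  by apply/seteqP; split => w /= h k; apply: h.
apply: filterS => w h; apply: contrapT => /negP nadj.
(* Times 0 to n+1 make n+2 entries, so the default value of [nth] is never read. *)
apply: (h (mkseq (S ^~ w) n.+2)); first by rewrite !nth_mkseq.
by move=> k kn; rewrite nth_mkseq.
Qed.

Context (p : R) (mu : probability nat R) (F : frogs G Omega).
Hypothesis FM : frog_model P p mu F.

Let mF : forall j, frogs_sigma F j `<=` measurable. Proof. by case: FM. Qed.

Lemma ae_nearest_neighbour : \forall w \ae P, nearest_neighbour F w.
Proof.
have [_ _ _ srw _] := FM.
apply: ae_forall_countable => x; apply: ae_foralln => i.
apply: filterI.
  by apply: ae_in; [exact: (measurable_walk mF _ _ _ [set _])|case: (srw x i)].
apply: ae_foralln => n; apply: simple_random_walk_adj (srw _ _) => k s.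
exact: measurable_walk.
Qed.

Definition survives_to (k : nat) : set (option nat) :=
  [set l | before_death k l].

(** The complement contains the disjoint events that the lifetime is 1, ..., k, whose geometric
    masses add up to 1 - p^k. *)
Lemma life_geq_le x i k : (P (life F x i @^-1` survives_to k) <= (p ^+ k)%:E)%E.
Proof.
have [_ _ _ _ /(_ x i)[geo _]] := FM.
have -> : life F x i @^-1` survives_to k =
    ~` (life F x i @^-1` (~` survives_to k)).
  by rewrite preimage_setC setCK.
rewrite probability_setC; last exact: measurable_life.
have -> : (p ^+ k)%:E = (1 - (1 - p ^+ k)%:E)%E.
  by rewrite -EFinB opprB addrC subrK.
apply: leeB => //.
have -> : 1 - p ^+ k = \sum_(j < k) (1 - p) * p ^+ j.
  by rewrite -[LHS]opprB subrX1 -mulNr opprB mulr_sumr.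
rewrite -sumEFin.
under eq_bigr do rewrite -geo.
rewrite -(measure_bigsetU_ord P) //; first last.
- apply/trivIsetP => a b _ _ /eqP ab; apply/seteqP; split => w //= [-> []].
  by move/val_inj/ab.
- by move=> j; exact: measurable_life.
apply: le_measure; rewrite ?inE; [|exact: measurable_life|].
  by apply: bigsetU_measurable => j _; exact: measurable_life.
apply: (big_ind (fun A => A `<=` _)) => [|A B AS BS|j _]; first exact: sub0set.
  by rewrite subUset.
by move=> w /= ->; rewrite /survives_to /=; apply/negP; rewrite -leqNgt.
Qed.

Lemma ae_mortal : 0 <= p < 1 -> \forall w \ae P, mortal F w.
Proof.
move=> p01; apply: ae_forall_countable => x; apply: ae_foralln => i.
suff : \forall w \ae P, ~ (life F x i @^-1` [set None]) w by [].
apply: ae_notin; first exact: measurable_life.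
apply/eqP; rewrite eq_le measure_ge0 andbT.
apply: (le0_geometric p01) => k.
apply: le_trans (life_geq_le x i k).
by apply: le_measure; rewrite ?inE; try exact: measurable_life; move=> w /= ->.
Qed.

End AlmostSure.

(** * The chain estimate *)

Section ChainBound.
Context (R : realType) (G : rooted_graph) (d : measure_display)
  (Omega : measurableType d) (P : probability Omega R).
Context (p : R) (mu : probability nat R) (F : frogs G Omega).
Hypothesis FM : frog_model P p mu F.
Hypothesis p01 : 0 <= p < 1.

Let mF : forall j, frogs_sigma F j `<=` measurable. Proof. by case: FM. Qed.

Let event := (frogs_index G * set Omega)%type.

Definition site_of (j : frogs_index G) : G :=
  match j with
  | inl x => x
  | inr (inl (x, _)) => x
  | inr (inr (x, _)) => x
  end.

Definition joint (s : seq event) : set Omega := \big[setI/setT]_(u <- s) u.2.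

(** Indices must be distinct but sites may repeat: eta(x) and a lifetime at x can both be listed. *)
Definition base_events (s : seq event) : Prop :=
  uniq (map fst s) /\ forall u, u \in s -> frogs_sigma F u.1 u.2.

Lemma base_events_cons u s : base_events s -> u.1 \notin map fst s ->
  frogs_sigma F u.1 u.2 -> base_events (u :: s).
Proof.
move=> [us sF] us' uF; split; first by rewrite /= us' us.
by move=> v; rewrite inE => /predU1P[->|/sF].
Qed.

Lemma measurable_joint s : base_events s -> measurable (joint s).
Proof.
move=> [_ sF]; rewrite /joint big_seq.
apply: (big_ind (fun A => measurable A)) => [|A B|u us].
- exact: measurableT.
- exact: measurableI.
- by apply: (mF (sF _ us)).
Qed.

Lemma joint_independent s :
  base_events s -> P (joint s) = (\prod_(u <- s) P u.2)%E.
Proof.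
have [_ indep _ _ _] := FM => -[us sF].
(* [mutual_independence] takes events as a function of the index; distinct indices allow the pairs
   of [s] to be read as such a function. *)
have [A AE] : exists A : frogs_index G -> set Omega,
    forall u, u \in s -> A u.1 = u.2.
  elim: s us {sF} => [|u s IHs]; first by move=> _; exists (fun=> setT).
  rewrite [map _ _]/= cons_uniq => /andP[us /IHs[A AE]].
  exists (fun j => if j == u.1 then u.2 else A j) => v.
  rewrite inE => /predU1P[->|vs]; first by rewrite eqxx.
  case: eqP => [vu|_]; last exact: AE.
  by rewrite -vu map_f in us.
have -> : joint s = \bigcap_(j in [set` map fst s]) A j.
  rewrite bigcap_seq big_map /joint; apply: eq_big_seq => u us'.
  by rewrite AE.
rewrite indep //.
  by rewrite big_map; apply: eq_big_seq => u us'; rewrite AE.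
by move=> j /mapP[u us' ->]; rewrite AE //; exact: sF.
Qed.

Lemma joint_cons_independent u s :
  base_events (u :: s) -> P (u.2 `&` joint s) = (P u.2 * P (joint s))%E.
Proof.
move=> us.
have -> : u.2 `&` joint s = joint (u :: s) by rewrite /joint big_cons.
rewrite joint_independent // big_cons joint_independent //.
case: us => /andP[_ us] sF; split=> // v vs; apply: sF.
by rewrite inE vs orbT.
Qed.

Context (a C : R).
Hypotheses (a01 : 0 < a <= 1) (C1 : 1 <= C).
Hypothesis moment :
  (\sum_(0 <= n <oo) mu [set n] * (n%:R `^ a)%:E <= C%:E)%E.

(** For x >= 1 the power is at least 1; for 0 < x < 1 it is at least x because a <= 1. *)
Lemma min1_le_powR (x : R) : 0 <= x -> Num.min 1 x <= x `^ a.
Proof.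
case/andP: a01 => a0 a1; rewrite le_eqVlt => /predU1P[<-|x0].
  by rewrite ge_min powR_ge0 orbT.
have [x1|x1] := leP 1 x.
  by rewrite -[1](powRr0 x) ler_powR // ltW.
by rewrite -[leLHS]powRr1 ?(ltW x0) // ger_powR // x0 ltW.
Qed.

(* The events in [s] are the values of eta and of a lifetime at the sites already
   treated: the induction on [r] conditions on eta(x) and then bounds the union
   over the frogs of x by the smaller of 1 and the sum. *)
Lemma all_far_le (r : seq (G * nat)) (s : seq event) :
    uniq (map fst r) -> base_events s ->
    (forall u, u \in s -> site_of u.1 \notin map fst r) ->
  (P (joint s `&` all_far F r)
     <= ((C * p `^ a) ^+ sumn (map snd r))%:E * P (joint s))%E.
Proof.
case/andP: p01 => p0 p1.
elim: r s => [|[x k] r IHr] s.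
  move=> _ sF _; rewrite expr0 mul1e; apply: le_measure; rewrite ?inE.
  - by apply: measurableI; [exact: measurable_joint|exact: measurable_all_far].
  - exact: measurable_joint.
  - exact: subIsetl.
rewrite [map fst _]/= cons_uniq => /andP[xr ur] sF sx.
have mr := measurable_all_far mF r.
have sr u : u \in s -> site_of u.1 \notin map fst r.
  by move=> /sx; rewrite inE negb_or => /andP[].
have mH : measurable (joint s `&` all_far F r).
  by apply: measurableI => //; exact: measurable_joint.
(* An empty leg adds nothing to the exponent, so its event is simply dropped. *)
case: k => [|k].
  rewrite /= add0n; apply: le_trans (IHr s ur sF sr).
  rewrite all_far_cons; apply: le_measure; rewrite ?inE //.
  - apply: measurableI; first exact: measurable_joint.
    by apply: measurableI => //; exact: measurable_far.
  - by move=> w [? [_ ?]].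
set K := k.+1; pose N n := nfrogs F x @^-1` [set n].
pose L i := life F x i @^-1` survives_to K.
pose H := joint s `&` all_far F r.
have mN n : measurable (N n) by exact: measurable_nfrogs.
have mL i : measurable (L i) by exact: measurable_life.
(* The site [x] is still untreated, so eta(x) and the lifetimes at [x] have fresh indices. *)
have xs j : site_of j = x -> j \notin map fst s.
  move=> jx; apply/mapP => -[u us ju]; have := sx _ us.
  by rewrite -ju jx inE eqxx.
have sFN n : base_events ((inl x, N n) :: s).
  apply: base_events_cons => //; first exact: xs.
  exact: (@sigma_of_preimage _ _ _ (fun _ : unit => nfrogs F x) tt [set n]).
have sFL n i : base_events ((inr (inr (x, i)), L i) :: (inl x, N n) :: s).
  apply: base_events_cons => //.
    by rewrite inE; apply: xs.
  exact: (@sigma_of_preimage _ _ _ (fun _ : unit => life F x i) tt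
    (survives_to K)).
have [c c0 cE] : exists2 c : R, 0 <= c & P (joint s) = c%:E.
  exists (fine (P (joint s))); first exact: fine_ge0.
  by rewrite fineK //; apply: fin_num_measure; exact: measurable_joint.
have [q qE] : exists q : nat -> R, forall n, mu [set n] = (q n)%:E.
  exists (fun n => fine (mu [set n])) => n.
  by rewrite fineK //; apply: fin_num_measure.
have q0 n : 0 <= q n by rewrite -lee_fin -qE.
have PN n : P (N n) = (q n)%:E by rewrite -qE; have [_ _ + _ _] := FM; apply.
set psi := C * p `^ a; set m := sumn (map snd r).
have psi0 : 0 <= psi by rewrite mulr_ge0 ?powR_ge0 // (le_trans _ C1).
(* The induction hypothesis is used with the event eta(x) = n added to [s], and below also with one
   lifetime at [x]; the joint probability then factors. *)
have PNH n : (P (N n `&` H) <= (psi ^+ m * c * q n)%:E)%E.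
  have := IHr _ ur (sFN n); rewrite /joint big_cons -/(joint s) -setIA -/H.
  rewrite joint_cons_independent // PN cE -!EFinM [q n * c]mulrC mulrA; apply.
  by move=> u; rewrite inE => /predU1P[->|/sr].
have PLNH n i : (P (L i `&` (N n `&` H)) <= (psi ^+ m * c * q n * p ^+ K)%:E)%E.
  have := IHr _ ur (sFL n i); rewrite /joint 2!big_cons -/(joint s) -!setIA -/H.
  have := joint_cons_independent (sFL n i).
  rewrite [joint _ in X in X -> _]/joint big_cons -/(joint s) => ->.
  rewrite joint_cons_independent // => h; apply: le_trans (h _) _.
    by move=> u; rewrite !inE => /or3P[/eqP->|/eqP->|/sr].
  rewrite PN cE.
  have := life_geq_le FM x i K; rewrite -/(L i) => PL.
  rewrite muleCA [leLHS]/=; apply: le_trans (lee_wpmul2r _ PL) _.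
    by rewrite lee_fin !mulr_ge0 // exprn_ge0.
  by rewrite -!EFinM lee_fin le_eqVlt; apply/orP; left; apply/eqP; ring.
pose X n := (N n `&` \big[setU/set0]_(i < n) L i) `&` H.
have mX n : measurable (X n).
  apply: measurableI => //; apply: measurableI => //.
  by apply: bigsetU_measurable.
have PX n : (P (X n) <= (psi ^+ m * c * (p `^ a) ^+ K)%:E *
                        (mu [set n] * (n%:R `^ a)%:E))%E.
  have pK : (n%:R * p ^+ K) `^ a = n%:R `^ a * (p `^ a) ^+ K.
    by rewrite powRM ?exprn_ge0 // powR_exprn.
  (* The bound 1 comes from forgetting the lifetimes, the bound n p^K from the union over the n
     frogs. *)
  have Xmin :
      (P (X n) <= (psi ^+ m * c * q n * Num.min 1 (n%:R * p ^+ K))%:E)%E.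
    rewrite minEle; case: ifP => _.
      rewrite mulr1; apply: le_trans (PNH n).
      apply: le_measure; rewrite ?inE //.
        exact: measurableI.
      by move=> w [[? _] ?].
    have -> : X n = \big[setU/set0]_(i < n) (L i `&` (N n `&` H)).
      by rewrite -big_distrl /= /X setIAC [RHS]setIC.
    have -> : psi ^+ m * c * q n * (n%:R * p ^+ K) =
              \sum_(i < n) psi ^+ m * c * q n * p ^+ K.
      by rewrite sumr_const card_ord -mulr_natl; ring.
    rewrite -sumEFin.
    apply: measure_bigsetU_le => [i _|i _]; last exact: PLNH.
    by apply: measurableI => //; exact: measurableI.
  apply: le_trans Xmin _; rewrite qE -!EFinM lee_fin.
  rewrite [leRHS](_ : _ = psi ^+ m * c * q n * (n%:R * p ^+ K) `^ a).
    by apply: ler_wpM2l; [rewrite !mulr_ge0 ?exprn_ge0|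
      rewrite min1_le_powR // mulr_ge0 ?exprn_ge0].
  by rewrite pK; ring.
(* The events [X n] cover the target as n runs over the values of eta(x); summing over n makes the
   moment of order [a] appear. *)
apply: (@le_trans _ _ (\sum_(0 <= n <oo) P (X n))%E).
  apply: measure_sigma_subadditive => //.
    apply: measurableI; first exact: measurable_joint.
    exact: measurable_all_far.
  rewrite all_far_cons => w [sw [[//|[i ix iK]] rw]].
  exists (nfrogs F x w) => //; split=> //; split=> //.
  by rewrite -bigcup_mkord; exists i.
apply: (@le_trans _ _ (\sum_(0 <= n <oo) (psi ^+ m * c * (p `^ a) ^+ K)%:E *
                        (mu [set n] * (n%:R `^ a)%:E))%E).
  by apply: lee_nneseries => // n _; exact: measure_ge0.
rewrite nneseriesZl; last first.
  by move=> n _; rewrite mule_ge0 // lee_fin powR_ge0.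
apply: le_trans (lee_wpmul2l _ moment) _.
  by rewrite lee_fin !mulr_ge0 ?exprn_ge0 ?powR_ge0.
rewrite cE -!EFinM lee_fin /= exprD /psi [in leRHS]exprMn -/psi -/K.
(* The leg costs a single factor [C], absorbed into C^K since K >= 1, so that the bound depends on
   the total length only. *)
have CK : C <= C ^+ K by rewrite ler_eXnr.
rewrite [leLHS](_ : _ = C * (psi ^+ m * c * (p `^ a) ^+ K)); last by ring.
rewrite [leRHS](_ : _ = C ^+ K * (psi ^+ m * c * (p `^ a) ^+ K)); last by ring.
by apply: ler_wpM2r => //; rewrite !mulr_ge0 ?exprn_ge0 ?powR_ge0.
Qed.

Context (deg : nat).
Hypothesis degG : forall x : G, degree x = deg.

(** Union bound: [all_far_le] applies to the walks with distinct relay sites, and the sum is then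
    enlarged to all (2 deg)^n marked walks by nonnegativity. *)
Lemma chain_le n :
  (P (\big[setU/set0]_(t <- marked_walks n (origin G)
         | uniq (map fst (legs (origin G) 0 t))) all_far F (legs (origin G) 0 t))
   <= (((2 * deg)%:R * (C * p `^ a)) ^+ n)%:E)%E.
Proof.
set psi := C * p `^ a.
have psi0 : 0 <= psi by rewrite mulr_ge0 ?powR_ge0 // (le_trans _ C1).
rewrite exprMn -natrX -(size_marked_walks degG n (origin G)).
have : forall t, t \in marked_walks n (origin G) -> size t = n.
  move: (origin G); elim: n => [|n IHn] x t /=; first by rewrite inE => /eqP->.
  by move/allpairsPdep => [u [t' [_ /IHn <- ->]]].
move: (marked_walks _ _) => l ln.
rewrite (_ : (_ * _)%:E = \sum_(t <- l) (psi ^+ n)%:E)%E; last first.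
  by rewrite sumEFin big_const_seq count_predT iter_addr_0 mulr_natl.
rewrite [leRHS]big_seq; apply: (@le_trans _ _
    (\sum_(t <- l | (t \in l) && uniq (map fst (legs (origin G) 0 t)))
       (psi ^+ n)%:E)%E).
  rewrite big_seq_cond; apply: measure_bigsetU_le => t /andP[tl ut].
    exact: measurable_all_far.
  have := @all_far_le (legs (origin G) 0 t) [::] ut.
  rewrite /joint big_nil setTI probability_setT mule1 sumn_legs add0n ln //.
  by apply=> //; split.
by apply: lee_sum_nneg => t _ _; rewrite lee_fin exprn_ge0.
Qed.

Hypothesis subcritical : (2 * deg)%:R * (C * p `^ a) < 1.

Lemma survival_null : P (survival R F) = 0%E.
Proof.
have mS := measurable_survival mF R.
apply/eqP; rewrite eq_le measure_ge0 andbT.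
have psi0 : 0 <= C * p `^ a by rewrite mulr_ge0 ?powR_ge0 // (le_trans _ C1).
apply: (@le0_geometric _ ((2 * deg)%:R * (C * p `^ a))) => [|n].
  by rewrite subcritical mulr_ge0.
apply: le_trans (chain_le n).
have : \forall w \ae P, nearest_neighbour F w /\ mortal F w.
  by apply: filterI; [exact: ae_nearest_neighbour FM|exact: ae_mortal FM p01].
(* [B] is a null set containing all exceptional outcomes; adding it to the union of chain events
   costs nothing. *)
move=> [B [mB B0 NB]].
set E := \big[_/_]_(_ <- _ | _) _.
have mE : measurable E.
  by apply: bigsetU_measurable => t _; exact: measurable_all_far.
rewrite -[leRHS]adde0 -B0; apply: le_trans (measureU2 _ mE mB).
apply: le_measure; rewrite ?inE //; first exact: measurableU.
move=> w sw; have [Bw|nBw] := pselect (B w); [by right|left].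
have [nnw mw] : nearest_neighbour F w /\ mortal F w.
  by apply: contrapT => h; apply: nBw; exact: NB.
have [t [tm ut tw]] := infinite_activated_chain n nnw (survival_infinite mw sw).
by rewrite /E -bigcup_seq_cond; exists t => //=; rewrite tm ut.
Qed.

End ChainBound.

(** * The moment of eta as a series, and the choice of the threshold *)

Lemma expectation_nat_powR (R : realType) (d : measure_display)
    (Omega : measurableType d) (P : probability Omega R)
    (eta : {RV P >-> nat}) (b : R) :
  ('E_P[(fun w => (eta w)%:R `^ b)%R] =
   \sum_(0 <= n <oo) distribution P eta [set n] * (n%:R `^ b)%:E)%E.
Proof.
rewrite unlock.
have mN n : measurable (eta @^-1` [set n]).
  by rewrite -[X in measurable X]setTI; exact: measurable_funP.
have distE n : distribution P eta [set n] = P (eta @^-1` [set n]) by [].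
have <- : \bigcup_n (eta @^-1` [set n]) = setT.
  by apply/seteqP; split=> w // _; exists (eta w).
rewrite ge0_integral_bigcup //=.
- apply: eq_eseriesr => n _.
  rewrite distE muleC -(integral_cst P (mN n)).
  by apply: eq_integral => w; rewrite inE /= => ->.
- apply: measurable_funTS; apply/measurable_EFinP.
  apply: (@measurableT_comp _ _ _ _ _ _ (fun n : nat => n%:R `^ b : R)) => //.
- apply/trivIsetP => i j _ _ /eqP ij; apply/seteqP; split => w //= [wi wj].
  by apply: ij; rewrite -wi -wj.
Qed.

Theorem theorem1p2 (R : realType) (d : nat) (Td : rooted_graph)
    (dO : measure_display) (Omega0 : measurableType dO)
    (P0 : probability Omega0 R) (eta : {RV P0 >-> nat}) :
  (3 <= d)%N ->
  homogeneous_tree d Td ->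
  (0 < P0 [set w | (1 <= eta w)%N])%E ->
  (exists2 delta : R, 0 < delta &
    ('E_P0[(fun w => (eta w)%:R `^ delta)%R] < +oo)%E) ->
  (0 < p_c Td (distribution P0 eta))%E /\
  (exists2 p0 : R, 0 < p0 & forall p : R, 0 < p -> p < p0 ->
    dies_out_almost_surely Td p (distribution P0 eta)).
Proof.
move=> d3 [_ degT] _ [delta delta0].
rewrite expectation_nat_powR; set mu := distribution P0 eta => fin_moment.
pose a := Num.min delta 1.
have a01 : 0 < a <= 1 by rewrite lt_min delta0 ltr01 ge_min lexx orbT.
have [a0 a1] := andP a01.
pose C := Num.max 1 (fine (\sum_(0 <= n <oo) mu [set n] * (n%:R `^ delta)%:E)).
have C1 : 1 <= C by rewrite le_max lexx.
have moment : (\sum_(0 <= n <oo) mu [set n] * (n%:R `^ a)%:E <= C%:E)%E.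
  have h0 : (0 <= \sum_(0 <= n <oo) mu [set n] * (n%:R `^ delta)%:E)%E.
    by apply: nneseries_ge0 => n _ _; rewrite mule_ge0 // lee_fin powR_ge0.
  apply: (@le_trans _ _ (\sum_(0 <= n <oo) mu [set n] * (n%:R `^ delta)%:E)%E).
    apply: lee_nneseries => [n _ _|n _].
      by rewrite mule_ge0 // lee_fin powR_ge0.
    apply: lee_wpmul2l => //; rewrite lee_fin.
    (* At n = 0 both powers vanish, the exponents being positive; for n >= 1 the power increases
       with the exponent. *)
    case: n => [|n]; first by rewrite !powR0 ?gt_eqF.
    by apply: ler_powR; rewrite ?ler1n // ge_min lexx.
  by rewrite -[leLHS]fineK ?ge0_fin_numE // lee_fin le_max lexx orbT.
have [D [DE D_gt0]] : exists D : R, D = (2 * d)%:R * C /\ 0 < D.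
  eexists; split; first by [].
  by rewrite mulr_gt0 ?(lt_le_trans _ C1) // ltr0n muln_gt0 /= (leq_trans _ d3).
(* For p >= 0, p < D^(-1/a) means D p^a < 1, the subcritical condition; the minimum with 1 ensures p
   < 1, hence finite lifetimes almost surely. *)
pose p0 := Num.min 1 (D^-1 `^ a^-1).
have p00 : 0 < p0 by rewrite lt_min ltr01 powR_gt0 // invr_gt0.
have null p (e : measure_display) (Omega : measurableType e)
    (P : probability Omega R) (F : frogs Td Omega) :
  0 <= p < p0 -> frog_model P p mu F -> P (survival R F) = 0%E.
  move=> /andP[p_ge0]; rewrite lt_min => /andP[p1 pp0] FM.
  apply: (survival_null FM _ a01 C1 moment degT); first by rewrite p_ge0.
  have pa : p `^ a < D^-1.
    have -> : D^-1 = (D^-1 `^ a^-1) `^ a.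
      by rewrite -powRrM mulVf ?gt_eqF // powRr1 // invr_ge0 ltW.
    by apply: gt0_ltr_powR; rewrite ?nnegrE ?powR_ge0.
  by rewrite mulrA -DE; move: pa; rewrite -(ltr_pM2l D_gt0) mulfV // gt_eqF.
split; last first.
  exists p0 => // p p_gt0 pp0 e Omega P F FM.
  have [mF _ _ _ _] := FM.
  rewrite probability_setC; last exact: measurable_survival.
  by rewrite (null p) ?sube0 // (ltW p_gt0).
(* No parameter below [p0], including p = 0, gives survival with positive probability, so [p0] is a
   lower bound of the set. *)
apply: (@lt_le_trans _ _ p0%:E); first by rewrite lte_fin.
apply/ereal_infP => _ [p [/andP[p_ge0 _] [e [T [P [F [FM sF]]]]]] <-].
rewrite lee_fin leNgt; apply/negP => pp0.
by move: sF; rewrite (null p) ?ltxx // p_ge0.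
Qed.
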